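(* Let $k,d,q\geq 2$ be integers. There is a function $\varepsilon_{k,d,q}(n)$ with $\varepsilon_{k,d,q}(n) \to 0$ as $n\to\infty$ such that every $k$-uniform hypergraph $H$ on $n$ vertices with $d_1(H)=d$ satisfies $r(H;q)\leq n^{1+\varepsilon_{k,d,q}(n)}$.
   Context: The $q$-color Ramsey number $r(H;q)$ is the minimum $N$ such that every $q$-coloring of the edges of the complete $k$-uniform hypergraph $K_N^{(k)}$ contains a monochromatic copy of $H$. The skeletal degeneracy $d_1(H)$ is the degeneracy of the $1$-skeleton of $H$ (the graph on $V(H)$ joining two vertices iff they lie in a common edge of $H$), i.e. the least $d$ such that every subgraph of that graph has minimum degree at most $d$. *)

(* Defs.v *)
From mathcomp Require Import all_boot.

Set Implicit Arguments.
Unset Strict Implicit.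
Unset Printing Implicit Defensive.

Record uhypergraph (k : nat) (V : finType) := UHypergraph {
  edges : {set {set V}};
  edges_uniform : {in edges, forall e : {set V}, #|e| = k}
}.

(* Graphs on V are given by their edge sets, made of two-element sets. *)
Definition skeleton (k : nat) (V : finType) (H : uhypergraph k V) :
    {set {set V}} :=
  [set p : {set V} | (#|p| == 2) && [exists e in edges H, p \subset e]].

Definition degree (V : finType) (F : {set {set V}}) (v : V) : nat :=
  #|[set p in F | v \in p]|.

(* (S, F) ranges over the nonempty, not necessarily induced, subgraphs of G. *)
Definition degenerate (V : finType) (G : {set {set V}}) (d : nat) : bool :=
  [forall S : {set V}, forall F : {set {set V}},
     [&& S != set0, F \subset G & F \subset powerset S] ==>
     [exists v in S, degree F v <= d]].

Lemma degenerate_exists (V : finType) (G : {set {set V}}) :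
  exists d, degenerate G d.
Proof.
exists #|G|; apply/forallP => S; apply/forallP => F.
apply/implyP => /and3P[/set0Pn[v vS] FG _].
apply/existsP; exists v; rewrite vS /=.
apply: leq_trans (subset_leq_card FG).
by apply/subset_leq_card/subsetP => p; rewrite inE => /andP[].
Qed.

Definition degeneracy (V : finType) (G : {set {set V}}) : nat :=
  ex_minn (degenerate_exists G).

Definition skeletal_degeneracy (k : nat) (V : finType)
    (H : uhypergraph k V) : nat :=
  degeneracy (skeleton H).

Definition complete_edge (k N : nat) : Type :=
  {e : {set 'I_N} | #|e| == k}.

(* The edges of the copy are the images under f of the edges of H; they have
   size k by injectivity of f, so each is the value of a complete_edge. *)
Definition monochromatic_copy (k N q : nat) (V : finType)
    (H : uhypergraph k V) (c : complete_edge k N -> 'I_q) : Prop :=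
  exists2 f : V -> 'I_N, injective f &
  exists i : 'I_q, forall x : complete_edge k N,
    val x \in [set f @: (e : {set V}) | e in edges H] -> c x = i.

Definition ramsey (k : nat) (V : finType) (H : uhypergraph k V) (q N : nat) :
    Prop :=
  forall c : complete_edge k N -> 'I_q, monochromatic_copy H c.

Definition is_ramsey_number (k : nat) (V : finType) (H : uhypergraph k V)
    (q r : nat) : Prop :=
  ramsey H q r /\ forall N, ramsey H q N -> r <= N.

(* Main.v *)
(* Dependent random choice seeded by Ramsey's theorem. Take a random map f from a
   large constant index set K to the N vertices. By Ramsey's theorem every
   injective f is monochromatic on some set of indices, which is split into d + 1
   blocks of size t, one for each colour class of a proper colouring of the
   skeleton. H is embedded greedily along a degeneracy order, so that the
   embedded part of each edge, completed by arbitrary members of the blocks of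
   its remaining vertices, is an edge of the chosen colour i. When v is
   embedded, its at most d earlier neighbours determine the set X of admissible
   images, and X contains the whole image of the block of v. The step can only
   fail if |X| <= n. But X does not depend on f on that block, so such a failure
   has probability at most (n / N)^t, whereas there are only O(N^d) choices of
   images for the earlier neighbours. For t = d (a + 1) and N^a > C n^(a + 1) the
   union bound leaves an injective f without failures. Letting a grow gives the
   exponent 1 + o(1). *)

Require Import Defs.
From HB Require Import structures.
From mathcomp Require Import all_boot.
From mathcomp Require Import zify.

Set Implicit Arguments.
Unset Strict Implicit.
Unset Printing Implicit Defensive.

(** * Finite tools: Ramsey's theorem and the counting of maps *)

Lemma card_bigcup_leq (P T : finType) (F : P -> {set T}) (m : nat) :
  (forall p, #|F p| <= m) -> #|\bigcup_p F p| <= #|P| * m.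
Proof.
move=> leF; rewrite -sum_nat_const [leqRHS](eq_bigl xpredT) //.
apply: (@leq_trans (\sum_p #|F p|)); last by apply: leq_sum => p _.
elim/big_ind2: _ => [|A a B b leA leB|//]; first by rewrite cards0.
by apply: leq_trans (leq_add leA leB); rewrite cardsU leq_subr.
Qed.

Definition monochromatic_on (V : finType) (C : Type) (k : nat)
    (c : {set V} -> C) (B : {set V}) (i : C) : Prop :=
  forall e : {set V}, e \subset B -> #|e| = k -> c e = i.

(** Induction on [k]. Sets [h i], one per colour, grow together: the case [k], applied to the link
    of a vertex [x], confines the search to a [B] over which all edges through [x] have one colour
    [i0], so [x] can join [h i0]. Pigeonhole applies once the total size exceeds [q * m]. *)
Lemma hypergraph_ramsey (k q m : nat) : exists K, forall (V : finType)
    (c : {set V} -> 'I_q) (A : {set V}), K <= #|A| ->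
  exists (B : {set V}) i, [/\ B \subset A, m <= #|B| & monochromatic_on k c B i].
Proof.
elim: k m => [|k IHk] m.
  exists m => V c A leA; exists A, (c set0); split=> // e _ /eqP.
  by rewrite cards_eq0 => /eqP ->.
have [K HK] : exists K, forall (V : finType) (c : {set V} -> 'I_q)
    (A : {set V}), K <= #|A| -> exists h : 'I_q -> {set V},
    q * m < \sum_i #|h i| /\
    forall i, h i \subset A /\ monochromatic_on k.+1 c (h i) i.
  elim: (q * m).+1 => [|L [K IHL]].
    exists 0 => V c A _; exists (fun=> set0); split=> // i; split.
      exact: sub0set.
    by move=> e /subset_leq_card; rewrite cards0 => + eE; rewrite eE.
  have [K' HK'] := IHk K; exists K'.+1 => V c A ltA.
  have /card_gt0P[x xA] : 0 < #|A| by apply: leq_trans ltA.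
  have leAx : K' <= #|A :\ x| by move: ltA; rewrite (cardsD1 x A) xA.
  have [B [i0 [BA leB Bi]]] := HK' _ (fun e => c (x |: e)) _ leAx.
  have [h [hL hP]] := IHL _ c _ leB.
  have xB : x \notin B by apply/negP => /(subsetP BA); rewrite !inE eqxx.
  have xh i : x \notin h i.
    by apply: contra xB; apply: (subsetP (hP i).1).
  exists (fun i => if i == i0 then x |: h i else h i); split.
    rewrite (bigD1 i0) //= eqxx cardsU1 xh; rewrite (bigD1 i0) //= in hL.
    rewrite (eq_bigr (fun i => #|h i|)); last by move=> i /negPf ->.
    by rewrite -addnA add1n ltnS.
  have BA' : B \subset A by apply: subset_trans BA (subsetDl _ _).
  move=> i; case: eqP => [->|_]; last first.
    by split; [apply: subset_trans (hP i).1 BA' | exact: (hP i).2].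
  split; first by rewrite subUset sub1set xA (subset_trans (hP i0).1).
  move=> e esub cE; case: (boolP (x \in e)) => xe; last first.
    apply: (hP i0).2 => //; apply/subsetP => z ze.
    have /setU1P[zx|//] := subsetP esub z ze.
    by rewrite -zx ze in xe.
  have := Bi (e :\ x); rewrite setD1K //; apply.
    apply/subsetP => z /setD1P[zx ze].
    have /setU1P[/eqP|] := subsetP esub z ze; first by rewrite (negPf zx).
    exact: (subsetP (hP i0).1).
  by move: cE; rewrite (cardsD1 x) xe => -[].
exists K => V c A leA; have [h [hm hP]] := HK V c A leA.
have /existsP[i hi] : [exists i, m < #|h i|].
  apply: contraLR hm; rewrite negb_exists -leqNgt => /forallP le_h.
  rewrite -[X in X * m]card_ord -sum_nat_const; apply: leq_sum => i _.
  by rewrite leqNgt le_h.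
by exists (h i), i; split; [exact: (hP i).1|exact: ltnW|exact: (hP i).2].
Qed.

Lemma disjoint_blocks (T : finType) (D t : nat) (A : {set T}) :
  D * t <= #|A| -> exists B : {ffun 'I_D -> {set T}},
    [/\ forall l, B l \subset A, forall l, #|B l| = t &
        forall l l', l != l' -> [disjoint B l & B l']].
Proof.
case: t => [|t] leA.
  exists [ffun=> set0]; split=> [l|l|l l' _]; rewrite !ffunE ?sub0set ?cards0 //.
  by rewrite -setI_eq0 set0I.
case: (set_0Vmem A) leA => [->|[x0 x0A] leA].
  rewrite cards0 leqn0 muln_eq0 orbF => /eqP D0.
  by exists [ffun=> set0]; split=> -[l lD]; exfalso; rewrite D0 in lD.
pose g (l : 'I_D) (s : 'I_t.+1) := nth x0 (enum A) (l * t.+1 + s).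
have gsz (l : 'I_D) (s : 'I_t.+1) : l * t.+1 + s < size (enum A).
  rewrite -cardE; apply: leq_trans leA.
  have := ltn_ord l; have := ltn_ord s; nia.
have gI l s l' s' : g l s = g l' s' -> l = l' /\ s = s'.
  move/eqP; rewrite nth_uniq ?enum_uniq ?gsz // => /eqP E.
  have El : l = l'.
    apply: val_inj; have := congr1 (divn^~ t.+1) E => /=.
    by rewrite !divnMDl // !(divn_small (ltn_ord _)) !addn0.
  by split=> //; apply: val_inj; move: E; rewrite El => /addnI.
exists [ffun l => [set g l s | s : 'I_t.+1]]; split=> [l|l|l l' ll'];
    rewrite !ffunE.
- by apply/subsetP => _ /imsetP[s _ ->]; rewrite -mem_enum mem_nth ?gsz.
- by rewrite card_imset ?card_ord // => s s' /gI[].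
apply/pred0P => x /=; apply/negP => /andP[/imsetP[s _ ->] /imsetP[s' _ /gI[E _]]].
by rewrite E eqxx in ll'.
Qed.

(* Once [f] is fixed off [J], so is [X f], leaving at most [n] values for each
   [f b] with [b] in [J]. *)
Lemma card_self_confined_ffun (I T : finType) (J : {set I}) (n : nat)
    (X : {ffun I -> T} -> {set T}) :
    0 < n ->
    (forall f g : {ffun I -> T}, {in ~: J, f =1 g} -> X f = X g) ->
  #|[set f : {ffun I -> T} | (#|X f| <= n) && [forall b in J, f b \in X f]]|
    <= #|T| ^ (#|I| - #|J|) * n ^ #|J|.
Proof.
case: n => // n _ Xout; set S := [set f | _].
pose enc (f : {ffun I -> T}) :=
  ([ffun b : {b | b \in ~: J} => f (val b)],
   [ffun b : {b | b \in J} => inord (index (f (val b)) (enum (X f))) : 'I_n.+1]).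
have encI : {in S &, injective enc}.
  move=> f g; rewrite !inE => /andP[fn /forallP fX] /andP[gn /forallP gX].
  move=> -[/ffunP E1 /ffunP E2].
  have fg : {in ~: J, f =1 g}.
    by move=> b bJ; have := E1 (Sub b bJ); rewrite !ffunE.
  apply/ffunP => b; case: (boolP (b \in J)) => bJ; last first.
    by apply: fg; rewrite inE.
  have EX := Xout _ _ fg.
  have := E2 (Sub b bJ); rewrite !ffunE /= -EX => /(congr1 val) /=.
  have fbX := implyP (fX b) bJ; have := implyP (gX b) bJ; rewrite -EX => gbX.
  rewrite !inordK ?(leq_trans _ fn) // ?cardE ?index_mem ?mem_enum // => Ei.
  rewrite -(nth_index (f b) (s := enum (X f)) (x := f b)) ?mem_enum //.
  by rewrite Ei nth_index ?mem_enum.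
rewrite -(card_in_imset encI); apply: leq_trans (max_card _) _.
rewrite card_prod !card_ffun card_ord !card_sig.
rewrite (_ : #|[pred x | x \in ~: J]| = #|I| - #|J|) //.
by rewrite -[in RHS](setCK J) -cardsCs; apply: eq_card.
Qed.

(** The probabilistic choice as a count: [#|T| ^_ #|I|] is the number of injections, too many to be
    covered by the bad sets. *)
Lemma exists_injective_avoiding (P I T : finType) (m : nat)
    (bad : P -> {set {ffun I -> T}}) :
    (forall p, #|bad p| <= m) -> #|P| * m < #|T| ^_ #|I| ->
  exists2 f : {ffun I -> T}, injective f & forall p, f \notin bad p.
Proof.
move=> badm ltP; pose inj := [set f : {ffun I -> T} | injectiveb f].
have : ~~ (inj \subset \bigcup_p bad p).
  apply: contraTN ltP => /subset_leq_card; rewrite card_inj_ffuns -leqNgt.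
  by move/leq_trans; apply; apply: card_bigcup_leq.
case/subsetPn => f; rewrite inE => /injectiveP finj fbad.
exists f => // p; apply: contra fbad => fp.
by apply/bigcupP; exists p.
Qed.

(** * Degenerate skeletons: low degrees and proper colourings *)

Definition neighbours (k : nat) (V : finType) (H : uhypergraph k V) (v : V) :
    {set V} :=
  [set u | (u != v) && [exists e in edges H, (u \in e) && (v \in e)]].

(** Degeneracy is applied to the subgraph of the skeleton induced on [A]; pairing with [v] injects
    its neighbours into the edges at [v]. *)
Lemma degenerate_neighbours (k d : nat) (V : finType) (H : uhypergraph k V)
    (A : {set V}) :
    degenerate (skeleton H) d -> A != set0 ->
  exists2 v, v \in A & #|neighbours H v :&: A| <= d.
Proof.
move=> /forallP/(_ A)/forallP/(_ [set p in skeleton H | p \subset A]).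
rewrite [(_ \subset skeleton H)](_ : _ = true); last first.
  by apply/subsetP => p; rewrite inE => /andP[].
rewrite [(_ \subset powerset A)](_ : _ = true); last first.
  by apply/subsetP => p; rewrite !inE => /andP[].
rewrite !andbT => /implyP dA A0; move: (dA A0) => /existsP[v /andP[vA dv]].
exists v => //; apply: leq_trans dv.
have pI : {in neighbours H v :&: A &, injective (fun u => [set u; v])}.
  move=> u w; rewrite !inE => /andP[/andP[uv _] _] _ E.
  by have := setU11 u [set v]; rewrite E !inE (negPf uv) orbF => /eqP.
rewrite -(card_in_imset pI); apply: subset_leq_card.
apply/subsetP => _ /imsetP[u + ->].
rewrite !inE => /andP[/andP[uv /existsP[e /andP[eH /andP[ue ve]]]] uA].
rewrite cards2 uv eqxx orbT subUset !sub1set uA vA !andbT /=.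
by apply/existsP; exists e; rewrite eH subUset !sub1set ue.
Qed.

(** A vertex of low degree is coloured last: its at most [d] neighbours leave one of [d.+1] colours
    free. Distinct vertices of an edge are neighbours, so a proper colouring is injective on
    edges. *)
Lemma degenerate_colouring (k d : nat) (V : finType) (H : uhypergraph k V) :
    degenerate (skeleton H) d ->
  exists chi : V -> 'I_d.+1, {in edges H, forall e : {set V},
    {in e &, injective chi}}.
Proof.
move=> dH; suff [chi chiP] : exists chi : V -> 'I_d.+1,
    {in [set: V] &, forall u v, u \in neighbours H v -> chi u != chi v}.
  exists chi => e eH u v ue ve /eqP; apply: contraTeq => uv.
  apply: chiP; rewrite ?inE // uv.
  by apply/existsP; exists e; rewrite eH ue.
move: [set: V] => A; elim: {A}_.+1 {-2}A (ltnSn #|A|) => // m IHm A ltA.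
case: (eqVneq A set0) => [->|A0].
  by exists (fun=> ord0) => u v; rewrite inE.
have [v vA dv] := degenerate_neighbours dH A0.
have [|chi chiP] := IHm (A :\ v).
  by move: ltA; rewrite (cardsD1 v A) vA.
have /subsetPn[j _ jP] :
    ~~ ([set: 'I_d.+1] \subset chi @: (neighbours H v :&: A)).
  apply/negP => /subset_leq_card; rewrite cardsT card_ord leqNgt ltnS.
  by rewrite (leq_trans (leq_imset_card _ _)).
have nbr_sym u w : (u \in neighbours H w) = (w \in neighbours H u).
  rewrite !inE eq_sym; congr andb; apply: eq_existsb => e.
  by rewrite [(u \in e) && _]andbC.
have jN u : u \in A -> u \in neighbours H v -> chi u != j.
  move=> uA uv; apply: contraNneq jP => <-; apply: imset_f.
  by rewrite inE uv.
exists (fun u => if u == v then j else chi u) => u w uA wA.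
case: (eqVneq u v) (eqVneq w v) => [->|uv] [->|wv].
- by rewrite inE eqxx.
- by rewrite nbr_sym eq_sym => /jN ->.
- by move/jN ->.
by apply: chiP; rewrite !inE ?uv ?wv.
Qed.

(** * Greedy embedding with placeholders *)

Definition mono_edge (k : nat) (T : finType) (C : eqType) (c : {set T} -> C)
    (i : C) (e : {set T}) : bool := (#|e| == k) && (c e == i).

(* A pattern [p] stands for an edge through a vertex about to be embedded in
   part [j]: [p.1] indexes its embedded vertices inside [y], and [p.2] is the
   set of parts of its vertices that are still to come, for which arbitrary
   members of the blocks act as placeholders. *)
Definition extensions (k d D : nat) (I T : finType) (C : eqType)
    (c : {set T} -> C) (i : C) (B : 'I_D -> {set I}) (j : 'I_D)
    (F : {set {set 'I_d} * {set 'I_D}}) (y : 'I_d -> T) (f : I -> T) : {set T} :=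
  [set x | [forall p in F, [forall tau in family B,
    mono_edge k c i (x |: (y @: p.1 :|: [set f (tau l) | l in p.2 :\ j]))]]].

Lemma eq_extensions (k d D : nat) (I T : finType) (C : eqType)
    (c : {set T} -> C) (i : C) (B : 'I_D -> {set I}) (j : 'I_D)
    (F : {set {set 'I_d} * {set 'I_D}}) (y : 'I_d -> T) (f g : I -> T) :
    (forall l l', l != l' -> [disjoint B l & B l']) ->
    {in ~: B j, f =1 g} ->
  extensions k c i B j F y f = extensions k c i B j F y g.
Proof.
move=> Bdisj fg; apply/setP => x; rewrite !inE.
apply: eq_forallb => p; congr (_ ==> _).
apply: eq_forallb_in => tau /familyP tauB.
congr (mono_edge k c i (_ |: (_ :|: _))).
apply: eq_in_imset => l /setD1P[lj _]; apply: fg.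
by rewrite inE (disjointFr (Bdisj _ _ lj)).
Qed.

Lemma greedy_embedding (k d : nat) (V I T : finType) (H : uhypergraph k V)
    (C : eqType) (c : {set T} -> C) (i : C) (B : 'I_d.+1 -> {set I})
    (f : I -> T) (A0 : {set I}) :
    degenerate (skeleton H) d -> injective f ->
    (forall l, B l \subset A0) -> (forall l, B l != set0) ->
    (forall l l', l != l' -> [disjoint B l & B l']) ->
    monochromatic_on k (fun e : {set I} => c (f @: e)) A0 i ->
    (forall j F (y : 'I_d -> T),
       (forall b, b \in B j -> f b \in extensions k c i B j F y f) ->
       #|V| <= #|extensions k c i B j F y f|) ->
  exists2 phi : V -> T, injective phi &
    {in edges H, forall e : {set V}, c (phi @: e) = i}.
Proof.
move=> dH fI BA B0 Bdisj mono ext.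
have [chi chiP] := degenerate_colouring dH.
have [b0 _] := set0Pn _ (B0 ord0).
(* Placeholders complete the embedded part of every edge to an edge of the
   right colour. *)
pose good (A : {set V}) (phi : V -> T) := {in A &, injective phi} /\
  forall e tau, e \in edges H -> tau \in family B ->
    mono_edge k c i
      (phi @: (e :&: A) :|: [set f (tau l) | l in chi @: (e :\: A)]).
have tauI tau : tau \in family B -> injective tau.
  move=> /familyP tauB l l' E; apply/eqP; apply: contraTT (tauB l) => ll'.
  by rewrite E (disjointFl (Bdisj _ _ ll') (tauB l')).
have [tau0 tau0B] : exists tau : {ffun 'I_d.+1 -> I}, tau \in family B.
  exists [ffun l => xchoose (set0Pn _ (B0 l))].
  by apply/familyP => l; rewrite ffunE; apply: xchooseP.
suff [phi [phiI phiP]] : exists phi, good [set: V] phi.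
  exists phi; first by move=> u v; apply: phiI; rewrite inE.
  move=> e eH; have := phiP e tau0 eH tau0B.
  by rewrite setIT setDT !imset0 setU0 => /andP[_ /eqP].
move: [set: V] => A; elim: {A}_.+1 {-2}A (ltnSn #|A|) => // m IHm A ltA.
case: (eqVneq A set0) => [->|An0].
  exists (fun=> f b0); split=> [u v|e tau eH tauB]; first by rewrite inE.
  rewrite setI0 setD0 imset0 set0U.
  have -> : [set f (tau l) | l in chi @: e] = f @: (tau @: (chi @: e)).
    by rewrite -[RHS]imset_comp.
  have ce : #|tau @: (chi @: e)| = k.
    rewrite card_imset; last exact: tauI.
    by rewrite card_in_imset ?(edges_uniform eH) //; apply: chiP.
  rewrite /mono_edge card_imset // ce eqxx /=; apply/eqP; apply: mono => //.
  apply/subsetP => _ /imsetP[l _ ->].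
  by apply: (subsetP (BA l)); move/familyP: tauB.
have [v vA dv] := degenerate_neighbours dH An0.
have [|phi [phiI phiP]] := IHm (A :\ v).
  by move: ltA; rewrite (cardsD1 v A) vA.
set S := neighbours H v :&: A in dv.
(* The default [v] of [nth] pads [y] to length [d]; the size test in [idx] keeps the padding out of
   every pattern. *)
pose y (a : 'I_d) := phi (nth v (enum S) a).
pose idx (e : {set V}) :=
  [set a : 'I_d | (a < size (enum S)) && (nth v (enum S) a \in e)].
pose F := [set (idx e, chi @: (e :\: A)) | e in [set e in edges H | v \in e]].
have yE e : e \in edges H -> v \in e -> y @: idx e = phi @: (e :&: (A :\ v)).
  move=> eH ve; apply/setP => z; apply/imsetP/imsetP => -[u].
    rewrite inE => /andP[usz ue] ->; exists (nth v (enum S) u) => //.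
    have : nth v (enum S) u \in S by rewrite -mem_enum mem_nth.
    by rewrite !inE ue => /andP[/andP[-> _] ->].
  rewrite !inE => /and3P[ue uv uA] ->.
  have uS : u \in S.
    by rewrite !inE uv uA andbT; apply/existsP; exists e; rewrite eH ue.
  have ltu : index u (enum S) < size (enum S) by rewrite index_mem mem_enum.
  have ltd : index u (enum S) < d by rewrite (leq_trans ltu) // -cardE.
  exists (Ordinal ltd); rewrite ?inE /y /= nth_index ?mem_enum //.
  by rewrite ltu.
have DE (e : {set V}) : v \in e -> e :\: (A :\ v) = v |: (e :\: A).
  move=> ve; apply/setP => u; rewrite !inE negb_and negbK andb_orl.
  by case: eqP => [->|//]; rewrite ve.
(* Deleting part [j] in [extensions] makes that set independent of [f] on [B j]; here it removes
   nothing, as [chi] is injective on [e]. *)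
have chivD (e : {set V}) : e \in edges H -> v \in e ->
    chi @: (e :\: A) :\ chi v = chi @: (e :\: A).
  move=> eH ve; apply/setP => l; rewrite in_setD1; case: eqP => // ->.
  apply/esym/imsetP => -[u /setDP[ue uA]].
  by move/(chiP _ eH _ _ ve ue) => E; rewrite -E vA in uA.
(* Any [b] in the block of [v] may be the placeholder of [v], so the invariant itself shows [f b]
   admissible. *)
have Bext b : b \in B (chi v) -> f b \in extensions k c i B (chi v) F y f.
  move=> bB; rewrite inE; apply/forall_inP => _ /imsetP[e + ->].
  rewrite inE => /andP[eH ve]; apply/forall_inP => tau tauB /=.
  rewrite yE // setUCA.
  pose tau' := [ffun l => if l == chi v then b else tau l].
  have tau'B : tau' \in family B.
    by apply/familyP => l; rewrite ffunE; case: eqP => [->|_] //; move/familyP: tauB.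
  have := phiP e tau' eH tau'B.
  rewrite DE // imsetU1 imsetU1 ffunE eqxx.
  congr (mono_edge _ _ _ (_ :|: (_ |: _))); rewrite chivD //.
  by apply: eq_in_imset => l; rewrite -chivD // ffunE in_setD1 => /andP[/negPf ->].
have /subsetPn[x xext xphi] :
    ~~ (extensions k c i B (chi v) F y f \subset phi @: (A :\ v)).
  apply/negP => /subset_leq_card; rewrite leqNgt => /negP; apply.
  apply: leq_trans (ext _ _ _ Bext); apply: leq_ltn_trans (leq_imset_card _ _) _.
  by apply: leq_trans (max_card A); rewrite [leqRHS](cardsD1 v A) vA.
pose phi' u := if u == v then x else phi u.
have phi'E (e : {set V}) : phi' @: (e :&: (A :\ v)) = phi @: (e :&: (A :\ v)).
  by apply: eq_in_imset => u; rewrite !inE /phi' => /and3P[_ /negPf ->].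
exists phi'; split=> [u w uA wA|e tau eH tauB].
  rewrite /phi'; case: (eqVneq u v) (eqVneq w v) => [->|uv] [->|wv] //.
  - by move=> E; case/negP: xphi; rewrite E imset_f // !inE wv.
  - by move=> E; case/negP: xphi; rewrite -E imset_f // !inE uv.
  by apply: phiI; rewrite !inE ?uv ?wv.
case: (boolP (v \in e)) => ve; last first.
  have := phiP e tau eH tauB.
  have -> : e :&: (A :\ v) = e :&: A.
    apply/setP => u; rewrite !inE; case: eqP => [->|//].
    by rewrite (negPf ve).
  have -> : e :\: (A :\ v) = e :\: A.
    apply/setP => u; rewrite !inE; case: eqP => [->|//].
    by rewrite (negPf ve) !andbF.
  congr (mono_edge _ _ _ (_ :|: _)); apply: eq_in_imset => u.
  by rewrite /phi' inE => /andP[ue _]; case: eqP ue ve => // -> ->.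
have -> : e :&: A = v |: (e :&: (A :\ v)).
  by apply/setP => u; rewrite !inE; case: eqP => [->|//]; rewrite ve vA.
rewrite imsetU1 phi'E -setUA {1}/phi' eqxx -yE //.
move: xext; rewrite inE => /forall_inP/(_ (idx e, chi @: (e :\: A))).
have -> : (idx e, chi @: (e :\: A)) \in F.
  by apply/imsetP; exists e; rewrite // inE eH.
by move=> /(_ isT)/forall_inP/(_ tau tauB) /=; rewrite chivD.
Qed.

(** * Choice of parameters and integer bounds *)

(** Each factor [N - i] with [i < K] is at least [N / 2]. *)
Lemma expn_ffact_leq (N K : nat) : K.*2 <= N -> N ^ K <= 2 ^ K * N ^_ K.
Proof.
move=> leN; have expE m : m ^ K = \prod_(i < K) m.
  by rewrite prod_nat_const card_ord.
rewrite ffact_prod !expE -big_split.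
by apply: leq_prod => [[i ltiK] _] /=; lia.
Qed.

(** Otherwise, cancelling powers of [N] leaves [N ^ (d * a) <= 2 ^ K * p * n ^ (d * a.+1)], against
    the [d]-th power of the last hypothesis. The successor there makes the constant positive, hence
    at most its own [d]-th power. *)
Lemma union_bound_arith (a d K N n p : nat) :
    0 < d -> 0 < n -> d * a.+1 <= K -> K.*2 <= N ->
    (2 ^ K * p).+1 * n ^ a.+1 < N ^ a ->
  p * N ^ d * (N ^ (K - d * a.+1) * n ^ (d * a.+1)) < N ^_ K.
Proof.
set C := (_ * p).+1 => d0 n0 tK KN ltN; rewrite ltnNge; apply/negP => le_ff.
have N0 : 0 < N by move: tK KN d0; rewrite mulnS; lia.
have := leq_trans (expn_ffact_leq KN) (leq_mul (leqnn (2 ^ K)) le_ff).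
have -> : N ^ K = N ^ d * N ^ (K - d * a.+1) * N ^ (d * a).
  by rewrite -!expnD; congr (_ ^ _); move: tK; rewrite mulnS; lia.
have -> : 2 ^ K * (p * N ^ d * (N ^ (K - d * a.+1) * n ^ (d * a.+1))) =
  N ^ d * N ^ (K - d * a.+1) * (2 ^ K * p * n ^ (d * a.+1)) by lia.
rewrite leq_pmul2l ?muln_gt0 ?expn_gt0 ?N0 // leqNgt => /negP; apply.
apply: (@leq_ltn_trans ((C * n ^ a.+1) ^ d)).
  rewrite expnMn -expnM [a.+1 * d]mulnC leq_mul2r.
  apply/orP; right; apply: ltnW; apply: (@leq_trans (C ^ 1)); [rewrite expn1 | rewrite leq_pexp2l] => //.
by rewrite [d * a]mulnC expnM ltn_exp2r.
Qed.

Lemma ramsey_of_large (k d q a : nat) : 0 < d -> 0 < q ->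
  exists K p : nat, forall (n N : nat) (V : finType) (H : uhypergraph k V),
    #|V| = n -> 0 < n -> degenerate (skeleton H) d ->
    K.*2 <= N -> p.+1 * n ^ a.+1 < N ^ a -> ramsey H q N.
Proof.
move=> d0; case: q => // q _.
set t := d * a.+1; have [K0 HK0] := hypergraph_ramsey k q.+1 (d.+1 * t).
set K := maxn K0 t.
(* The size of [P0] does not depend on [n] or [N]; only the tuple [y] costs a factor [N ^ d]. All
   choices of blocks are included because Ramsey's theorem yields the blocks only after [f] is
   fixed. *)
pose P0 := ({ffun 'I_d.+1 -> {set 'I_K}} * 'I_d.+1 *
            {set {set 'I_d} * {set 'I_d.+1}} * 'I_q.+1)%type.
exists K, (2 ^ K * #|{: P0}|) => n N V H Vn n0 dH KN ltN c.
pose c' (e : {set 'I_N}) := if insub e is Some x then c x else ord0.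
pose X (p : P0 * {ffun 'I_d -> 'I_N}) (f : {ffun 'I_K -> 'I_N}) :=
  let: (B, j, F, i, y) := p in extensions k c' i B j F y f.
(* With the conditions on blocks inside the bad set, ill-formed indices have an empty one and a
   single bound serves all [p]. *)
pose bad (p : P0 * {ffun 'I_d -> 'I_N}) :=
  let: (B, j, F, i, y) := p in
  [set f : {ffun 'I_K -> 'I_N} |
    [&& [forall l, forall l', (l != l') ==> [disjoint B l & B l']], #|B j| == t,
        #|X p f| <= n & [forall b in B j, f b \in X p f]]].
have bad_le p : #|bad p| <= N ^ (K - t) * n ^ t.
  case: p => -[[[B j] F] i] y.
  case: (boolP ([forall l, forall l', (l != l') ==> [disjoint B l & B l']]
                && (#|B j| == t))) => [/andP[Bdisj /eqP Bt]|nB].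
    have := @card_self_confined_ffun _ _ (B j) n (X (B, j, F, i, y)) n0.
    rewrite !card_ord Bt => le; apply: leq_trans (le _).
      by apply/subset_leq_card/subsetP => f; rewrite !inE => /and4P[_ _ -> ->].
    move=> f g fg; apply: eq_extensions => // l l' ll'.
    by move/forallP: Bdisj => /(_ l)/forallP/(_ l')/implyP; apply.
  rewrite (_ : bad _ = set0) ?cards0 //; apply/setP => f.
  by rewrite !inE andbA (negPf nB).
have [|f fI fgood] := exists_injective_avoiding bad_le.
  rewrite card_prod card_ffun !card_ord; apply: union_bound_arith => //.
  exact: leq_maxr.
have [|A [i [_ leA mono]]] := HK0 _ (fun e : {set 'I_K} => c' (f @: e)) [set: 'I_K].
  by rewrite cardsT card_ord leq_maxl.
have [B [BA Bt Bdisj]] := disjoint_blocks leA.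
have B0 l : B l != set0 by rewrite -card_gt0 Bt muln_gt0 d0.
have [j F y Bext|phi phiI phiP] := greedy_embedding dH fI BA B0 Bdisj mono.
  rewrite leqNgt; apply/negP => lt_ext.
  have /negP[] := fgood (B, j, F, i, [ffun a => y a]).
  have EX : X (B, j, F, i, [ffun a => y a]) f = extensions k c' i B j F y f.
    apply/setP => x; rewrite !inE; apply: eq_forallb => p; congr (_ ==> _).
    apply: eq_forallb => tau; congr (_ ==> mono_edge k c' i (_ |: (_ :|: _))).
    by apply: eq_imset => b; rewrite ffunE.
  rewrite inE EX Bt eqxx -Vn (ltnW lt_ext) /=; apply/andP; split.
    apply/forallP => l; apply/forallP => l'; apply/implyP; exact: Bdisj.
  by apply/forall_inP => b /Bext.
exists phi => //; exists i => x /imsetP[e eH xE].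
by rewrite -(phiP e eH) -xE /c' valK.
Qed.

(** For the least [N] with [M * n ^ a.+1 < N ^ a], minimality gives [N ^ a <= 2 ^ a * M * n ^ a.+1],
    and [2 ^ a * M <= n] for large [n]. *)
Lemma ramsey_exponent (k d q a : nat) : 0 < d -> 0 < q -> 0 < a ->
  exists n0, forall n, n0 <= n -> exists2 N, N ^ a <= n ^ a.+2 &
    forall (V : finType) (H : uhypergraph k V),
      #|V| = n -> degenerate (skeleton H) d -> ramsey H q N.
Proof.
move=> d0 q0 a0; have [K [p HKp]] := ramsey_of_large k a d0 q0.
(* The factor [K.*2.+1 ^ a] forces [K.*2 <= N]. *)
set M := p.+1 * K.*2.+1 ^ a.
have M0 : 0 < M by rewrite muln_gt0 expn_gt0.
exists (2 ^ a * M) => n len.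
have n0 : 0 < n by apply: leq_trans len; rewrite muln_gt0 expn_gt0.
have exN : exists N, M * n ^ a.+1 < N ^ a.
  by exists (M * n ^ a.+1).+1; rewrite -{1}[(_ * _).+1]expn1 leq_pexp2l.
case: (ex_minnP exN) => N ltN minN.
have N_gt j : j ^ a <= M * n ^ a.+1 -> j < N.
  by apply: contraTltn => leNj; rewrite -ltnNge (leq_trans ltN) // leq_exp2r.
have M1 : M <= M * n ^ a.+1 by rewrite leq_pmulr ?expn_gt0 ?n0.
have N1 : 1 < N by apply: N_gt; rewrite exp1n (leq_trans M0).
have NK : K.*2 <= N.
  apply/ltnW/N_gt; apply: leq_trans M1; rewrite -[X in X <= _]mul1n.
  by rewrite leq_mul // leq_exp2r.
exists N => [|V H Vn dH]; last first.
  apply: (HKp n) => //; apply: leq_ltn_trans ltN.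
  by rewrite leq_mul2r leq_pmulr ?expn_gt0 // orbT.
have le_pred : N.-1 ^ a <= M * n ^ a.+1.
  by rewrite leqNgt; apply/negP => /minN; lia.
have le_double : N ^ a <= 2 ^ a * N.-1 ^ a.
  by rewrite -expnMn leq_exp2r //; lia.
apply: leq_trans le_double _; rewrite expnS.
apply: leq_trans (leq_mul (leqnn _) le_pred) _.
by rewrite mulnA leq_mul.
Qed.

Lemma skeletal_degeneracyP (k : nat) (V : finType) (H : uhypergraph k V) :
  degenerate (skeleton H) (skeletal_degeneracy H).
Proof. by rewrite /skeletal_degeneracy /degeneracy; case: ex_minnP. Qed.

(** On at most one vertex the skeleton has no edges. The bound makes [ln n] positive later. *)
Lemma card_gt1_of_degeneracy (k : nat) (V : finType) (H : uhypergraph k V) :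
  0 < skeletal_degeneracy H -> 1 < #|V|.
Proof.
apply: contraLR; rewrite -!leqNgt => V1.
rewrite /skeletal_degeneracy /degeneracy; case: ex_minnP => d _; apply.
apply/forallP => S; apply/forallP => F; apply/implyP => /and3P[/set0Pn[v vS] FH _].
apply/existsP; exists v; rewrite vS leqn0 cards_eq0 /=; apply/eqP/setP => e.
rewrite !inE; apply/negP => /andP[/(subsetP FH)]; rewrite inE => /andP[/eqP e2 _].
by have := max_card e; rewrite e2 ltnNge V1.
Qed.

(* Passage to real exponents *)
From mathcomp Require Import all_order all_algebra.
From mathcomp Require Import all_classical all_reals all_analysis.
From mathcomp Require Import lra.

Import Order.TTheory GRing.Theory Num.Theory.
Import numFieldNormedType.Exports.
Local Open Scope classical_set_scope.
Local Open Scope ring_scope.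

Lemma is_ramsey_number_exists (k q N : nat) (V : finType) (H : uhypergraph k V) :
  ramsey H q N -> exists2 r, is_ramsey_number H q r & (r <= N)%N.
Proof.
move=> HN; have exr : exists r, `[< ramsey H q r >] by exists N; apply/asboolP.
case: (ex_minnP exr) => r /asboolP Hr minr; exists r.
  by split=> // M HM; apply: minr; apply/asboolP.
by apply: minr; apply/asboolP.
Qed.

(** Taking logarithms bounds the quotient by [1 + 2 / a]; the maximum with 0 leaves only this upper
    bound to check. *)
Lemma excess_cvg0 (R : realType) (u : nat -> nat) :
    (forall a, (0 < a)%N -> \forall n \near \oo, (u n ^ a <= n ^ a.+2)%N) ->
  Num.max 0 (ln (u n)%:R / ln n%:R - 1 : R) @[n --> \oo] --> (0 : R).
Proof.
move=> uP; apply/cvgrPdist_le => e e0.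
pose a := (Num.truncn (2 / e)).+1.
have a0 : 0 < a%:R :> R by rewrite ltr0n.
have ea : 2 / a%:R <= e.
  rewrite ler_pdivrMr // mulrC -ler_pdivrMr //; apply: ltW.
  exact: truncnS_gt.
near=> n.
have n1 : (1 < n)%N by near: n; exact: nbhs_infty_gt.
have un : (u n ^ a <= n ^ a.+2)%N by near: n; exact: uP.
have lnn : 0 < ln n%:R :> R by rewrite ln_gt0 // ltr1n.
rewrite sub0r normrN ger0_norm ?le_max ?lexx // ge_max (ltW e0) /=.
have [un0|un0] := posnP (u n).
  (* By convention [ln 0 = 0], so the excess is [-1] here. *)
  by rewrite un0 ln0 // mul0r; lra.
rewrite lerBlDr; apply: le_trans (_ : 2 / a%:R + 1 <= _); last by rewrite lerD2r.
rewrite ler_pdivrMr // -(ler_pM2l a0).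
have -> : a%:R * ((2 / a%:R + 1) * ln n%:R) = (a.+2)%:R * ln n%:R :> R.
  by rewrite mulrA mulrDr mulrCA divff ?gt_eqF // !mulr1 -natrD add2n.
rewrite !mulr_natl -!lnXn ?ltr0n ?(ltnW n1) //.
by rewrite ler_ln ?posrE ?exprn_gt0 ?ltr0n ?(ltnW n1) // -!natrX ler_nat.
Unshelve. all: by end_near. Qed.

Lemma natr_le_powR_excess (R : realType) (m n : nat) : (1 < n)%N ->
  m%:R <= (n%:R : R) `^ (1 + Num.max 0 (ln m%:R / ln n%:R - 1)).
Proof.
move=> n1; have [->|m0] := posnP m; first exact: powR_ge0.
have lnn : 0 < ln n%:R :> R by rewrite ln_gt0 // ltr1n.
have n0 : 0 < n%:R :> R by rewrite ltr0n ltnW.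
apply: (@le_trans _ _ ((n%:R : R) `^ (ln m%:R / ln n%:R))).
  by rewrite /powR gt_eqF // mulfVK ?gt_eqF // lnK // posrE ltr0n.
apply: ler_powR; first by rewrite ler1n ltnW.
by rewrite -lerBlDl le_max lexx orbT.
Qed.

Theorem theorem4p1 (R : realType) (k d q : nat)
    (hk : (2 <= k)%N) (hd : (2 <= d)%N) (hq : (2 <= q)%N) :
  exists eps : nat -> R,
    eps n @[n --> \oo] --> (0 : R) /\
    forall (n : nat) (V : finType) (H : uhypergraph k V),
      #|V| = n -> skeletal_degeneracy H = d ->
      exists r : nat,
        is_ramsey_number H q r /\ r%:R <= (n%:R : R) `^ (1 + eps n).
Proof.
have d0 : (0 < d)%N by rewrite ltnW.
have q0 : (0 < q)%N by rewrite ltnW.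
pose bounds n N := (0 < n)%N -> forall (V : finType) (H : uhypergraph k V),
  #|V| = n -> degenerate (skeleton H) d ->
  exists2 r, is_ramsey_number H q r & (r <= N)%N.
have ex_bound n : exists N, `[< bounds n N >].
  have [K [p Kp]] := ramsey_of_large k 1 d0 q0.
  exists (K.*2 + (p.+1 * n ^ 2).+1)%N; apply/asboolP => n0 V H Vn dH.
  apply: is_ramsey_number_exists; apply: (Kp n) => //; first exact: leq_addr.
  by rewrite expn1 addnS ltnS leq_addl.
(* The least bound common to all [H] on [n] vertices makes [eps] depend on [n] alone; by minimality
   it obeys the bound for each [a] once [n] is large. *)
pose u n := ex_minn (ex_bound n).
exists (fun n => Num.max 0 (ln (u n)%:R / ln n%:R - 1)); split.
  apply: excess_cvg0 => a a0; have [n0 Hn0] := ramsey_exponent k d0 q0 a0.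
  near=> n; have [|N leN HN] := Hn0 n; first by near: n; exact: nbhs_infty_ge.
  apply: leq_trans leN; rewrite leq_exp2r // /u; case: ex_minnP => m _; apply.
  by apply/asboolP => _ V H Vn dH; apply/is_ramsey_number_exists/HN.
move=> n V H Vn Hd.
have n1 : (1 < n)%N by rewrite -Vn; apply: (@card_gt1_of_degeneracy k _ H); rewrite Hd.
have [r Hr le_r] : exists2 r, is_ramsey_number H q r & (r <= u n)%N.
  rewrite /u; case: ex_minnP => m /asboolP + _; apply=> //; first exact: ltnW.
  by rewrite -Hd; exact: skeletal_degeneracyP.
exists r; split=> //; apply: le_trans (natr_le_powR_excess _ _ n1).
by rewrite ler_nat.
Unshelve. all: by end_near. Qed.
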